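(* For any number $g\ge 1$ of good agents, no algorithm solves the gathering problem (GAT) without any global knowledge. That is, for each $g\ge 1$, in systems with $g$ good agents, there is no algorithm $\mathcal{A}(id,n',k',f',\Lambda_g')$ that solves GAT for any values of the arguments $(n',k',f',\Lambda_g')$.
   Context: Network: a simple, connected, undirected graph $G=(V,E)$ with $n=|V|$ nodes. Nodes have no IDs. Each node $v$ assigns distinct port numbers in $\{1,\dots,d(v)\}$ to its incident edges, where $d(v)$ is its degree; the two endpoints of an edge may assign it different port numbers. Agents: there are $k$ agents with pairwise distinct IDs; each initially knows only its own ID. Agents have unbounded memory and cannot leave information on nodes or edges. Exactly $f$ agents are (weakly) Byzantine: they behave arbitrarily but cannot falsify their IDs. All non-Byzantine agents are called good; their number is $g=k-f$. $\Lambda_g$ is the length of the largest ID among IDs of good agents. Algorithm: for an agent with ID $id$, a deterministic algorithm is $\mathcal{A}(id,n',k',f',\Lambda_g')=(S,\delta,s_{ini},S_{ter})$, with a set of states $S$, a transition function $\delta$, a special state $s_{ini}\in S$ in which all variables are initialized, and a set of terminal states $S_{ter}\subseteq S$; only $\delta$ depends on $id$. The integers $n',k',f',\Lambda_g'$ (global knowledge) correspond to $n,k,f,\Lambda_g$ and take the same value for all agents. An algorithm solves a problem ''without global knowledge'' if $\mathcal{A}(id,n',k',f',\Lambda_g')$ solves it for any values of $(n',k',f',\Lambda_g')$. Execution: time proceeds in synchronous rounds. An agent may be dormant; a dormant agent transitions into $s_{ini}$ when the adversary wakes it up or when a non-dormant agent visits its node. In each round, each non-dormant agent at node $v$ (1)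 acquires $d(v)$, the port through which it arrived at $v$ in the previous round ($\bot$ if it stayed), and the states of all agents at $v$ (a Byzantine agent may present a falsified state, but presents the same state to all co-located agents, and its ID is identified correctly); (2) applies $\delta$ to this information and the arguments of $\mathcal{A}$ to obtain its next state and an outgoing port $p_{out}$ ($p_{out}=\bot$ means stay); (3) stays or moves through $p_{out}$, arriving by the next round. Agents crossing the same edge in opposite directions simultaneously do not notice this. Once an agent enters a state in $S_{ter}$, in every round from then on $\delta$ outputs $p_{out}=\bot$ and a next state in $S_{ter}$. The behavior of Byzantine agents is determined by an adversary. Gathering problem: a configuration is the combination of locations, states and IDs of all agents. $C_{ini}$ is the set of configurations in which at least one good agent is not dormant and every agent is either dormant or in state $s_{ini}$. An algorithm solves GAT if, for any graph $G$ and any initial configuration in $C_{ini}$, all good agents executing the algorithm in $G$ eventually enter terminal states at the same node simultaneously.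
   Formalization: For g = 1 the claim fails, since the lone good agent can terminate at once; so impossibility for exactly g good agents is stated for g ≥ 2, and for every g ≥ 1 it is stated for algorithms that must work with any number of good agents that is at least g. *)

(* Defs.v *)
From mathcomp Require Import all_boot.

Set Implicit Arguments.
Unset Strict Implicit.
Unset Printing Implicit Defensive.

(* [port u v] is the number assigned by [u] to the edge [uv]; its value is
   irrelevant when [u] and [v] are not adjacent. *)
Record port_graph := PortGraph {
  node :> finType;
  edge : rel node;
  port : node -> node -> nat;
  edge_sym : symmetric edge;
  edge_irr : irreflexive edge;
  edge_connected : forall u v, connect edge u v;
  port_range : forall u v, edge u v -> 1 <= port u v <= #|edge u|;
  port_inj : forall u, {in edge u &, injective (port u)}
}.

Definition degree (G : port_graph) (v : G) : nat := #|@edge G v|.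

Inductive status (S : Type) := Dormant | Active of S.
Arguments Dormant {S}.

(* [obs_agents i] is [Some x] if the agent with ID [i] is at the current node
   and shows status [x], and [None] if that agent is not there. *)
Record observation (S : Type) := Observation {
  obs_degree : nat;
  obs_in_port : option nat;
  obs_agents : nat -> option (status S)
}.

(* An algorithm for fixed values of the global knowledge; the first argument
   of [delta] is the ID of the agent, and the port [None] means "stay". *)
Record algorithm := Algorithm {
  state : Type;
  s_ini : state;
  S_ter : state -> Prop;
  delta : nat -> state -> observation state -> state * option nat;
  S_ter_halts : forall id s o, S_ter s ->
    S_ter (delta id s o).1 /\ (delta id s o).2 = None
}.

(* An algorithm A(_, n', k', f', Lambda_g'). *)
Definition knowledge_algorithm := nat -> nat -> nat -> nat -> algorithm.

(* New node and arrival port of an agent that leaves [v] through port [p].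
   An invalid port number is read as "stay". *)
Definition move (G : port_graph) (v : G) (p : option nat) : G * option nat :=
  if p is Some q then
    if [pick w | edge v w && (port v w == q)] is Some w
    then (w, Some (port w v)) else (v, None)
  else (v, None).

Section Execution.
Variables (alg : algorithm) (G : port_graph).
Variables (I : finType) (ident : I -> nat) (good : {set I}).

(* [in_port] records the port of arrival in the previous round. For a
   Byzantine agent, [stat] is the status it shows to the other agents. *)
Record config := Config {
  loc : I -> G;
  stat : I -> status (state alg);
  in_port : I -> option nat
}.

Definition dormant (c : config) (a : I) : Prop := stat c a = Dormant.

Definition observe (c : config) (a : I) : observation (state alg) :=
  Observation (degree (loc c a)) (in_port c a)
    (fun i => omap (stat c) [pick b | (ident b == i) && (loc c b == loc c a)]).

Definition initial (c : config) : Prop :=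
  [/\ exists2 a, a \in good & ~ dormant c a,
      forall a, dormant c a \/ stat c a = Active (s_ini alg)
    & forall a, in_port c a = None].

(* A non-dormant agent is at the node of [a] at the beginning of the round, or
   arrives there by its end. The former matters only when a dormant and a
   non-dormant agent share a node initially or after an adversarial wake-up. *)
Definition visited (c c' : config) (a : I) : Prop :=
  exists b, ~ dormant c b /\ (loc c b = loc c a \/ loc c' b = loc c a).

(* The adversary's choices are the nondeterminism of this relation: waking up
   dormant agents, and the moves and shown states of Byzantine agents. *)
Definition agent_step (c c' : config) (a : I) : Prop :=
  match stat c a with
  | Dormant =>
      [/\ loc c' a = loc c a, in_port c' a = None,
          visited c c' a -> ~ dormant c' a
        & a \in good -> dormant c' a \/ stat c' a = Active (s_ini alg)]
  | Active s =>
      if a \in good then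
        let: (s', p) := delta (ident a) s (observe c a) in
        stat c' a = Active s' /\ (loc c' a, in_port c' a) = move (loc c a) p
      else
        ~ dormant c' a /\
        exists p, (loc c' a, in_port c' a) = move (loc c a) p
  end.

Definition execution (E : nat -> config) : Prop :=
  initial (E 0) /\ forall t a, agent_step (E t) (E t.+1) a.

Definition terminated (c : config) (a : I) : Prop :=
  exists2 s, stat c a = Active s & S_ter s.

Definition enters_terminal (E : nat -> config) (a : I) (t : nat) : Prop :=
  terminated (E t) a /\ forall t', t' < t -> ~ terminated (E t') a.

Definition gathers (E : nat -> config) : Prop :=
  exists t v, forall a, a \in good -> enters_terminal E a t /\ loc (E t) a = v.

End Execution.

(* [Q] restricts the number of good agents; the graph, the number of Byzantine
   agents (possibly 0) and the IDs are arbitrary. *)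
Definition solves_GAT (Q : nat -> Prop) (alg : algorithm) : Prop :=
  forall (G : port_graph) (I : finType) (ident : I -> nat) (good : {set I}),
    injective ident -> Q #|good| ->
    forall E : nat -> config alg G I,
      execution ident good E -> gathers good E.

Definition solves_GAT_without_knowledge
    (Q : nat -> Prop) (A : knowledge_algorithm) : Prop :=
  forall n' k' f' Lambda_g', solves_GAT Q (A n' k' f' Lambda_g').

(* In systems with exactly one good agent GAT is solved by stopping at once,
   so impossibility for an exact number of good agents needs at least 2. *)
Lemma solves_GAT_one_good :
  exists A, solves_GAT_without_knowledge (fun m => m = 1) A.
Proof.
pose d (_ : nat) (_ : bool) (_ : observation bool) := (true, @None nat).
have dP id (s : bool) o : s -> (d id s o).1 /\ (d id s o).2 = None by [].
exists (fun _ _ _ _ => @Algorithm bool false is_true d dP).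
move=> _ _ _ _ G I ident good _ /eqP/cards1P[a ->] E [[[b]]].
rewrite inE => /eqP -> awake ini _ stepE; exists 1, (loc (E 1) a) => c.
rewrite inE => /eqP ->; split=> //.
have st0 : stat (E 0) a = Active (false : bool) by case: (ini a) => // /awake.
have := stepE 0 a; rewrite /agent_step st0 set11 /= => -[st1 _].
split; first by exists true.
by case=> // _ [s]; rewrite st0 => -[<-].
Qed.

(* Main.v *)
Require Import Defs.
From mathcomp Require Import all_boot.
From mathcomp Require Import zify.
From Stdlib Require Import FunctionalExtensionality.

(** Blow up each node of a cycle into a 2-clique, so that a node is a pair
    (layer, bit) and consecutive layers are completely joined. Let [g] good
    agents run alone in the thick ring with 3 layers: agent 0 halts after some
    [T] rounds, hence in a thick ring with more than [T + 1] layers the same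
    sequence of ports misses some layer. There keep agent 0 good, make its
    partners Byzantine, and put [g - 1] further good agents, dormant, in the
    missed layer. A partner can always stay in the layer of agent 0, at its
    node or at the other node of the layer, so it can show agent 0 exactly what
    agent 0 saw in the small ring. Agent 0 then replays its small run and the
    dormant good agents are never woken up. *)

Set Implicit Arguments.
Unset Strict Implicit.
Unset Printing Implicit Defensive.

(** * Successor and predecessor on a cycle of length at least 3 *)

Section CyclicOrdinals.
Variable n : nat.
Implicit Type x : 'I_n.+3.

Lemma val_ordS x : ordS x = (if x == n.+2 :> nat then 0 else x.+1) :> nat.
Proof.
have ltx := ltn_ord x; rewrite /=; case: eqP => [->|ne]; first by rewrite modnn.
by rewrite modn_small //; lia.
Qed.

Lemma val_ord_pred x :
  ord_pred x = (if x == 0 :> nat then n.+2 else x.-1) :> nat.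
Proof.
have ltx := ltn_ord x; rewrite /=; case: eqP => [->|ne].
  by rewrite modn_small.
have -> : (x + n.+3).-1 = x.-1 + n.+3 by lia.
by rewrite modnDr modn_small //; lia.
Qed.

Lemma ordS_neq x : (ordS x == x) = false.
Proof.
by apply/eqP => /(congr1 (@nat_of_ord _)); rewrite val_ordS; case: eqP; lia.
Qed.

Lemma ord_pred_neq x : (ord_pred x == x) = false.
Proof.
by apply/eqP => /(congr1 (@nat_of_ord _)); rewrite val_ord_pred; case: eqP; lia.
Qed.

Lemma ordS_neq_pred x : (ordS x == ord_pred x) = false.
Proof.
apply/eqP => /(congr1 (@nat_of_ord _)); rewrite val_ordS val_ord_pred.
by case: eqP; case: eqP; lia.
Qed.

Lemma ord_pred_neqS x : (ord_pred x == ordS x) = false.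
Proof. by rewrite eq_sym ordS_neq_pred. Qed.

Definition ord_neqs :=
  (ordS_neq, ord_pred_neq, ordS_neq_pred, ord_pred_neqS,
   (fun x => etrans (eq_sym x (ordS x)) (ordS_neq x)),
   (fun x => etrans (eq_sym x (ord_pred x)) (ord_pred_neq x))).

End CyclicOrdinals.

(** * The thick ring as a port-numbered graph *)

Section ThickRing.
Variable n : nat.
Let V := ('I_n.+3 * bool)%type.
Implicit Types u v w : V.

Definition thick_edge : rel V := fun u v =>
  [|| v.1 == ordS u.1, v.1 == ord_pred u.1 | (v.1 == u.1) && (v.2 != u.2)].

(** Ports encode the direction and the bit of the target but never the layer, so thick rings of
    different lengths look alike locally. *)
Definition thick_port u v : nat :=
  if v.1 == ordS u.1 then 1 + v.2
  else if v.1 == ord_pred u.1 then 3 + v.2 else 5.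

Lemma thick_edge_sym : symmetric thick_edge.
Proof.
move=> u v; rewrite /thick_edge.
have -> : (v.1 == ordS u.1) = (u.1 == ord_pred v.1).
  by apply/eqP/eqP => ->; rewrite ?ordSK ?ord_predK.
have -> : (v.1 == ord_pred u.1) = (u.1 == ordS v.1).
  by apply/eqP/eqP => ->; rewrite ?ordSK ?ord_predK.
by rewrite orbCA (eq_sym v.1 u.1) (eq_sym v.2 u.2).
Qed.

Lemma thick_edge_irr : irreflexive thick_edge.
Proof. by move=> u; rewrite /thick_edge !ord_neqs eqxx /= eqxx. Qed.

Lemma thick_edge_connected u v : connect thick_edge u v.
Proof.
have to0 m : forall (x : 'I_n.+3) y,
    x = m :> nat -> connect thick_edge (x, y) (ord0, false).
  elim: m => [|m IHm] x y xm.
    have -> : x = ord0 by apply: val_inj.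
    by case: y => //; apply: connect1; apply/or3P; apply: Or33; rewrite eqxx.
  apply: (@connect_trans _ _ (ord_pred x, false)).
    by apply: connect1; rewrite /thick_edge /= eqxx orbT.
  by apply: IHm; rewrite val_ord_pred xm.
case: u v => x y [x' y']; apply: connect_trans (to0 _ _ _ erefl) _.
by rewrite (sym_connect_sym thick_edge_sym) (to0 _ _ _ erefl).
Qed.

Lemma thick_edgeE u : thick_edge u =i
  [:: (ordS u.1, false); (ordS u.1, true); (ord_pred u.1, false);
      (ord_pred u.1, true); (u.1, ~~ u.2)].
Proof.
move=> v; rewrite !inE -topredE /= /thick_edge; case: u v => x y [x' y'] /=.
rewrite !xpair_eqE; case: y y' => -[] /=; rewrite ?andbT ?andbF ?orbF //=.
all: by rewrite ?orbA ?orbF.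
Qed.

(** With at least 3 layers the five listed neighbours are distinct; the degree thus reveals nothing
    about the length. *)
Lemma thick_degree u : #|thick_edge u| = 5.
Proof.
rewrite (eq_card (thick_edgeE u)); apply/card_uniqP.
by rewrite /= !inE !xpair_eqE !ord_neqs !andbF.
Qed.

Lemma thick_port_range u v : thick_edge u v ->
  1 <= thick_port u v <= #|thick_edge u|.
Proof.
by rewrite thick_degree /thick_port; case: ifP => _; [|case: ifP => _]; case: v.2.
Qed.

Lemma thick_port_inj u : {in thick_edge u &, injective (thick_port u)}.
Proof.
move=> v w; rewrite !thick_edgeE !inE => /predU1P[->|/or4P[]/eqP->].
all: by case/predU1P => [->|/or4P[]/eqP->];
  rewrite /thick_port /= ?eqxx ?ord_neqs.
Qed.

Definition thick_ring : port_graph :=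
  PortGraph thick_edge_sym thick_edge_irr thick_edge_connected
    thick_port_range thick_port_inj.

End ThickRing.

(** * Moves along edges, and their transfer from the 3-layer ring to longer ones *)

Lemma move_edge (G : port_graph) (u v : G) :
  edge u v -> move u (Some (port u v)) = (v, Some (port v u)).
Proof.
move=> uv; rewrite /move; case: pickP => [w /andP[uw /eqP puw]|/(_ v)].
  by rewrite (port_inj uw uv puw).
by rewrite uv eqxx.
Qed.

Definition arrival_port (G : port_graph) (u v : G) : option nat :=
  if u == v then None else Some (port v u).

Definition departure_port (G : port_graph) (u v : G) : option nat :=
  if u == v then None else Some (port u v).

Lemma move_departure (G : port_graph) (u v : G) : (u == v) || edge u v ->
  move u (departure_port u v) = (v, arrival_port u v).
Proof.
rewrite /departure_port /arrival_port; case: eqVneq => [->//|_] /=.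
exact: move_edge.
Qed.

Lemma move_thick_ring n (u : thick_ring n) q :
  move u (Some q) =
    match q with
    | 1 => (((ordS u.1, false) : thick_ring n), Some (3 + u.2))
    | 2 => ((ordS u.1, true), Some (3 + u.2))
    | 3 => ((ord_pred u.1, false), Some (1 + u.2))
    | 4 => ((ord_pred u.1, true), Some (1 + u.2))
    | 5 => ((u.1, ~~ u.2), Some 5)
    | _ => (u, None)
    end.
Proof.
have step (v : thick_ring n) : edge u v -> q = port u v ->
    move u (Some q) = (v, Some (port v u)).
  by move=> uv ->; apply: move_edge.
have arrS b : thick_port (ordS u.1, b) u = 3 + u.2.
  rewrite /thick_port /= ordSK eqxx; case: eqP => // uSS.
  by have := ordS_neq_pred u.1; rewrite {2}uSS ordSK eqxx.
have arrP b : thick_port (ord_pred u.1, b) u = 1 + u.2.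
  by rewrite /thick_port /= ord_predK eqxx.
have arr0 : thick_port (u.1, ~~ u.2) u = 5.
  by rewrite /thick_port /= !ord_neqs.
case: q step => [|[|[|[|[|[|q]]]]]] step.
- rewrite /move; case: pickP => // w /andP[/port_range/andP[+ _] /eqP wq].
  by rewrite wq.
- by rewrite -(arrS false); apply: step;
    rewrite /= /thick_edge /thick_port /= eqxx.
- by rewrite -(arrS true); apply: step;
    rewrite /= /thick_edge /thick_port /= eqxx.
- by rewrite -(arrP false); apply: step;
    rewrite /= /thick_edge /thick_port /= eqxx ?ord_neqs ?orbT.
- by rewrite -(arrP true); apply: step;
    rewrite /= /thick_edge /thick_port /= eqxx ?ord_neqs ?orbT.
- by rewrite -[in RHS]arr0; apply: step;
    rewrite /= /thick_edge /thick_port /= ?eqxx ?ord_neqs //=; case: u.2.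
- rewrite /move; case: pickP => // w /andP[/port_range/andP[_ +] /eqP wq].
  by rewrite wq (thick_degree u).
Qed.

(** In a cycle of length 3, [x'] is [x], its successor or its predecessor, so the pair determines a
    displacement 0, 1 or -1, which is applied to [X]. *)
Definition lift_layer n (x x' : 'I_3) (X : 'I_n.+3) : 'I_n.+3 :=
  if x' == ordS x then ordS X else if x' == ord_pred x then ord_pred X else X.

Lemma lift_layer_id n x (X : 'I_n.+3) : lift_layer x x X = X.
Proof. by rewrite /lift_layer !ord_neqs. Qed.

(** Since consecutive layers are completely joined, the bit can be chosen freely in every round;
    this lets Byzantine partners follow agent 0. *)
Lemma lift_layer_near n x x' (X : 'I_n.+3) b b' :
  let u : thick_ring n := (X, b) in
  let v : thick_ring n := (lift_layer x x' X, b') in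
  (u == v) || edge u v.
Proof.
rewrite /= /thick_edge /= /lift_layer xpair_eqE.
case: ifP => _; first by rewrite eqxx orbT.
case: ifP => _; first by rewrite eqxx !orbT.
by rewrite eqxx /= (eq_sym b'); case: (b == b'); rewrite ?orbT.
Qed.

Lemma move_lift n (x x' : 'I_3) (X : 'I_n.+3) b b' p r :
  move ((x, b) : thick_ring 0) p = ((x', b'), r) ->
  move ((X, b) : thick_ring n) p = ((lift_layer x x' X, b'), r).
Proof.
case: p => [q|[<- <- <-]]; last by rewrite lift_layer_id.
rewrite !move_thick_ring.
by case: q => [|[|[|[|[|[|q]]]]]] [<- <- <-] /=;
  rewrite /lift_layer ?eqxx ?ord_neqs.
Qed.

(** * The run in which all agents are good and awake at one node *)

Section HonestRun.
Variables (alg : algorithm) (G : port_graph) (I : finType) (ident : I -> nat).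
Variable v0 : G.

Record snapshot := Snapshot {
  sloc : I -> G; sstate : I -> state alg; sport : I -> option nat
}.

Definition config_of (s : snapshot) : config alg G I :=
  Config (sloc s) (fun a => Active (sstate s a)) (sport s).

Definition honest_next (s : snapshot) : snapshot :=
  let act a := delta (ident a) (sstate s a) (observe ident (config_of s) a) in
  let dest a := move (sloc s a) (act a).2 in
  Snapshot (fun a => (dest a).1) (fun a => (act a).1) (fun a => (dest a).2).

Definition honest_run (t : nat) : snapshot :=
  iter t honest_next
    (Snapshot (fun _ => v0) (fun _ => s_ini alg) (fun _ => None)).

Lemma honest_execution : 0 < #|I| ->
  execution ident [set: I] (fun t => config_of (honest_run t)).
Proof.
case/card_gt0P => a _; split; first by split=> //; [exists a | right].
move=> t b; rewrite /agent_step /= inE.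
by case: (delta _ _ _) => s p /=; case: (move _ _).
Qed.

Lemma honest_halt t a d :
  S_ter (sstate (honest_run t) a) ->
  sloc (honest_run (t + d)) a = sloc (honest_run t) a.
Proof.
move=> ter.
suff: S_ter (sstate (honest_run (t + d)) a) /\
      sloc (honest_run (t + d)) a = sloc (honest_run t) a by case.
elim: d => [|d [IHter IHloc]]; first by rewrite addn0.
rewrite addnS /=; set o := observe _ _ _.
by have [? ->] := S_ter_halts (ident a) o IHter.
Qed.

End HonestRun.

(** * Replaying the small run in a longer ring *)

Section Replay.
Variables (alg : algorithm) (g n : nat).
(** Only odd IDs are used, which leaves the even ones to the sleeping agents of the big run. *)
Definition small_ident (a : 'I_g.+1) : nat := a.*2.+1.

Let small t :=
  honest_run alg (G := thick_ring 0) small_ident (ord0, false) t.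
Let spot t (a : 'I_g.+1) : thick_ring 0 := sloc (small t) a.

(** The trajectory of agent 0 around the 3-cycle, lifted step by step to the longer cycle. *)
Fixpoint layer (t : nat) : 'I_n.+3 :=
  if t is t'.+1 then
    lift_layer (spot t' ord0).1 (spot t'.+1 ord0).1 (layer t')
  else ord0.

Lemma layer_halt T d : S_ter (sstate (small T) ord0) ->
  layer (T + d) = layer T.
Proof.
move=> ter; elim: d => [|d IHd]; first by rewrite addn0.
by rewrite addnS /= IHd -addnS /spot !honest_halt // lift_layer_id.
Qed.

(* Agent [(a, true)] plays the part of agent [a] of the small run; all agents
   [(a, false)] sleep. *)
Definition big_ident (a : 'I_g.+1 * bool) : nat := a.1.*2 + a.2.

Lemma big_ident_inj : injective big_ident.
Proof.
move=> [a b] [a' b'] /= e.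
have eb : b = b'.
  by move/(congr1 odd): e; rewrite !oddD !odd_double; case: b b' => -[].
by congr pair => //; apply: val_inj => /=; move: e; rewrite eb /big_ident /=; lia.
Qed.

(** One good agent per index: the awake copy for index 0, the sleeping copy for all others. *)
Definition big_good : {set 'I_g.+1 * bool} := [set (a, a == ord0) | a : 'I_g.+1].

Lemma mem_big_good a b : ((a, b) \in big_good) = (b == (a == ord0)).
Proof.
apply/imsetP/eqP => [[c _ [-> ->]] //|->]; by exists a.
Qed.

Lemma card_big_good : #|big_good| = g.+1.
Proof. by rewrite card_imset ?card_ord // => a a' []. Qed.

Variable Z : 'I_n.+3.
Hypothesis layer_neqZ : forall t, layer t != Z.

(** Agent 0 sees only its own node, so a partner need not copy its small position: it suffices to
    share the node of agent 0 exactly when it did so in the small run. *)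
Definition shadow t (a : 'I_g.+1) : thick_ring n :=
  (layer t, if spot t a == spot t ord0 then (spot t ord0).2
            else ~~ (spot t ord0).2).

Definition shadow_port t a : option nat :=
  if t is t'.+1 then
    if a == ord0 then sport (small t) a
    else arrival_port (shadow t' a) (shadow t a)
  else None.

Definition big_run t : config alg (thick_ring n) ('I_g.+1 * bool)%type :=
  Config (fun a => if a.2 then shadow t a.1 else ((Z, false) : thick_ring n))
    (fun a => if a.2 then Active (sstate (small t) a.1) else Dormant)
    (fun a => if a.2 then shadow_port t a.1 else None).

Lemma shadow_meets t a :
  (shadow t a == shadow t ord0) = (spot t a == spot t ord0).
Proof.
rewrite /shadow eqxx; case: ifP => _; first by rewrite eqxx.
by rewrite xpair_eqE eqxx; case: (_.2).
Qed.

Lemma observe_big_run t :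
  observe big_ident (big_run t) (ord0, true) =
  observe small_ident (config_of (small t)) ord0.
Proof.
rewrite /observe /=; congr Observation.
- by rewrite /degree /= !thick_degree.
- by case: t.
apply: functional_extensionality => k.
case: pickP => [[a b] /andP[/eqP ka /eqP la]|none];
  case: pickP => [c /andP[/eqP kc lc]|none'] //=.
- move: kc la; rewrite -ka => kc.
  have [<- <-] // : (c, true) = (a, b).
  by apply: big_ident_inj; rewrite -kc /big_ident addn1.
(* An awake agent met here was met in the small run too; a sleeping one would put agent 0 in layer
   [Z]. *)
- case: b ka la => /= ka la.
    have := none' a; rewrite -[_ == spot _ _]shadow_meets la eqxx andbT => /eqP[].
    by rewrite -ka /big_ident addn1.
  by have := layer_neqZ t; case: la => <- _; rewrite eqxx.
- have := none (c, true).
  rewrite /= shadow_meets [_ == _ in X in _ && X]lc andbT => /eqP[].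
  by rewrite -kc /big_ident addn1.
Qed.

Lemma big_run_execution : execution big_ident big_good big_run.
Proof.
split.
  split=> [|[a []]|[a []]] //=; try by [left | right].
  by exists (ord0, true); rewrite ?mem_big_good.
move=> t [a b]; rewrite /agent_step [stat _ _]/=; case: b; last first.
  (* All awake agents are in the layer of agent 0, so a visitor of a sleeper, at the start or the
     end of the round, would be in layer [Z]. *)
  split=> // [[[c []] [//= _ /= [] [lZ]]]|_]; last by left.
  - by have := layer_neqZ t; rewrite lZ eqxx.
  - by have := layer_neqZ t.+1; rewrite /= lZ eqxx.
rewrite mem_big_good [true == _]eq_sym eqb_id; case: eqP => [->|/eqP a0].
  rewrite observe_big_run.
  pose D := delta (small_ident ord0) (sstate (small t) ord0)
    (observe small_ident (config_of (small t)) ord0).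
  have mv : move (spot t ord0) D.2 = (spot t.+1 ord0, sport (small t.+1) ord0).
    exact: surjective_pairing.
  rewrite (_ : delta _ _ _ = (D.1, D.2)); last exact: surjective_pairing.
  split=> //.
  change ((shadow t.+1 ord0, sport (small t.+1) ord0) = move (shadow t ord0) D.2).
  rewrite /shadow !eqxx.
  change (layer t.+1) with
    (lift_layer (spot t ord0).1 (spot t.+1 ord0).1 (layer t)).
  move: D.2 (spot t ord0) (spot t.+1 ord0) (sport _ _) mv => p [x c] [x' c'] r.
  by move/(move_lift (layer t)).
split=> //.
(* A partner is Byzantine, so any legal move to its next shadow will do. *)
exists (departure_port (shadow t a) (shadow t.+1 a)).
have near : (shadow t a == shadow t.+1 a) || edge (shadow t a) (shadow t.+1 a).
  exact: lift_layer_near.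
by rewrite (move_departure near) /= (negPf a0).
Qed.

End Replay.

(** * Counting visited layers, and the contradiction *)

Lemma missed_layer alg g T :
    let small := honest_run alg (G := thick_ring 0) (@small_ident g) (ord0, false) in
    S_ter (sstate (small T) ord0) ->
  exists Z, forall t, layer alg g T t != Z.
Proof.
move=> small ter; pose seen := [set layer alg g T t | t : 'I_T.+1].
(* Rounds 0 to [T] visit at most [T + 1] of the [T + 3] layers. *)
have /subsetPn[Z _ Zseen] : ~~ ([set: 'I_T.+3] \subset seen).
  apply/negP => /subset_leq_card; rewrite cardsT card_ord leqNgt => /negP[].
  by apply: leq_ltn_trans (leq_imset_card _ _) _; rewrite card_ord.
exists Z => t; apply: contraNneq Zseen => <-.
(* After round [T] agent 0 has halted, so its layer remains the one of round [T]. *)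
have [tT|/ltnW/subnKC <-] := leqP t T; last rewrite layer_halt //.
  by apply/imsetP; exists (Ordinal (tT : t < T.+1)).
by apply/imsetP; exists ord_max.
Qed.

Lemma no_gathering g (alg : algorithm) :
  1 < g -> ~ solves_GAT (fun m => m = g) alg.
Proof.
case: g => [|[|g]] // _ solves.
have [] := solves (thick_ring 0) 'I_g.+2 (@small_ident g.+1) [set: 'I_g.+2] _ _ _
  (honest_execution alg (@small_ident g.+1) ((ord0, false) : thick_ring 0) _).
- by move=> a b /succn_inj/double_inj/val_inj.
- by rewrite cardsT card_ord.
- by rewrite card_ord.
move=> T [v /(_ ord0 (in_setT _)) [[[s [<-] ter] _] _]].
have [Z neqZ] := missed_layer ter.
have [] := solves _ _ _ _ (@big_ident_inj g.+1) (card_big_good _) _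
  (big_run_execution neqZ).
(* With at least two good agents [ord_max] differs from [ord0], so this agent is good; it is dormant
   forever and never terminates. *)
move=> T' [v' /(_ (ord_max, false))].
by rewrite mem_big_good => /(_ isT) [[[s']]].
Qed.

(* The first part is about systems with exactly [g] good agents (for [g = 1] it
   would contradict [solves_GAT_one_good]); the second one, for all [g >= 1], is
   about algorithms that must work for every number of good agents from [g] on. *)
Theorem theorem3p1 (g : nat) (g_ge1 : 1 <= g) :
  (1 < g ->
     ~ exists A : knowledge_algorithm,
         solves_GAT_without_knowledge (fun m => m = g) A) /\
  ~ exists A : knowledge_algorithm,
      solves_GAT_without_knowledge (fun m => g <= m) A.
Proof.
split=> [g_gt1 [A solves]|[A solves]].
  exact: no_gathering g_gt1 (solves 0 0 0 0).
(* Exactly [g + 1] good agents is an allowed number, and it is at least 2 even for [g = 1]. *)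
apply: (@no_gathering g.+1 (A 0 0 0 0)) => // G I ident good inj cardE.
by apply: solves => //; rewrite cardE.
Qed.
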